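(* Let $J\colon\mathcal S_n\to\mathbb R$ be strictly isotone and let Assumption (A1) hold. If the linear fusion rule $(\boldsymbol K_1^\ast,\boldsymbol K_2^\ast,\hat{\boldsymbol P}^\ast)\in\mathcal F_H$ is $J$-optimal, then it is a member of the Kahan-Uhlmann family $\mathcal K_H$ and is $J$-optimal over $\mathcal K_H$.
   Context: $n,p_1,p_2$ are positive integers, $p_1,p_2\le n$, $H_1\in\mathbb R^{p_1\times n}$, $H_2\in\mathbb R^{p_2\times n}$, $H=\begin{pmatrix}H_1\\H_2\end{pmatrix}$. Assumption (A1): $\mathrm{rk}(H_1)=p_1$, $\mathrm{rk}(H_2)=p_2$, $\mathrm{rk}(H)=n$ (and the two input estimators $\hat x_1,\hat x_2$ are unbiased estimators of $H_1x_{\rm true}$, $H_2x_{\rm true}$; in the deterministic maps below only their values enter). $\mathcal S_m,\mathcal P_m^\succ$: real symmetric, resp. positive definite, $m\times m$ matrices; $\preceq,\prec$ refer to the Löwner order. $\mathcal D_F:=\mathbb R^{p_1}\times\mathbb R^{p_2}\times\mathcal P_{p_1}^\succ\times\mathcal P_{p_2}^\succ$, with points denoted $(\hat x_1,\hat x_2,\hat P_1,\hat P_2)$. Statements about maps on $\mathcal D_F$ are read pointwise. $J$ is strictly isotone if $A\preceq B$ implies $J(A)\le J(B)$ and ($A\preceq B$, $A\ne B$) implies $J(A)<J(B)$, for all $A,B\in\mathcal S_n$. $\mathcal F_H$ is the set of maps (linear fusion rules) $(\boldsymbol K_1,\boldsymbol K_2,\hat{\boldsymbol P})\colon\mathcal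 D_F\to\mathbb R^{n\times p_1}\times\mathbb R^{n\times p_2}\times\mathcal P_n^\succ$ that are unbiased, i.e. $\boldsymbol K_1H_1+\boldsymbol K_2H_2=I$ on $\mathcal D_F$, and preserve conservativeness on $\mathcal P_{p_1+p_2}^\succ$, i.e. for all $(\hat x_1,\hat x_2,\hat P_1,\hat P_2)\in\mathcal D_F$ and all $P_{\rm joint}=\begin{pmatrix}P_1&P_{12}\\P_{12}^\top&P_2\end{pmatrix}\in\mathcal P_{p_1+p_2}^\succ$ with $P_1\preceq\hat P_1$ and $P_2\preceq\hat P_2$ one has $\begin{pmatrix}\boldsymbol K_1&\boldsymbol K_2\end{pmatrix}P_{\rm joint}\begin{pmatrix}\boldsymbol K_1&\boldsymbol K_2\end{pmatrix}^\top\preceq\hat{\boldsymbol P}$. $\mathcal K_H^{\boldsymbol\alpha}$ denotes the set of all functions $\boldsymbol\alpha\colon\mathcal D_F\to[0,1]$ such that, at each point of $\mathcal D_F$: $\boldsymbol\alpha=0$ if $H_2^\top\hat P_2^{-1}H_2\succ H_1^\top\hat P_1^{-1}H_1$; $\boldsymbol\alpha\in[0,1]$ is arbitrary if $H_2^\top\hat P_2^{-1}H_2=H_1^\top\hat P_1^{-1}H_1$; $\boldsymbol\alpha=1$ if $H_2^\top\hat P_2^{-1}H_2\prec H_1^\top\hat P_1^{-1}H_1$; and otherwise $\boldsymbol\alpha\in[0,1]$ is such that $\boldsymbol\alpha H_1^\top\hat P_1^{-1}H_1+(1-\boldsymbol\alpha)H_2^\top\hat P_2^{-1}H_2$ is non-singular.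 For $\boldsymbol\alpha\in\mathcal K_H^{\boldsymbol\alpha}$ define $\hat{\boldsymbol P}^{\boldsymbol\alpha}:=(\boldsymbol\alpha H_1^\top\hat P_1^{-1}H_1+(1-\boldsymbol\alpha)H_2^\top\hat P_2^{-1}H_2)^{-1}$, $\boldsymbol K_1^{\boldsymbol\alpha}:=\boldsymbol\alpha\hat{\boldsymbol P}^{\boldsymbol\alpha}H_1^\top\hat P_1^{-1}$, $\boldsymbol K_2^{\boldsymbol\alpha}:=(1-\boldsymbol\alpha)\hat{\boldsymbol P}^{\boldsymbol\alpha}H_2^\top\hat P_2^{-1}$. The Kahan-Uhlmann family is $\mathcal K_H:=\{(\boldsymbol K_1^{\boldsymbol\alpha},\boldsymbol K_2^{\boldsymbol\alpha},\hat{\boldsymbol P}^{\boldsymbol\alpha}) : \boldsymbol\alpha\in\mathcal K_H^{\boldsymbol\alpha}\}$. An element $(\boldsymbol K_1^\ast,\boldsymbol K_2^\ast,\hat{\boldsymbol P}^\ast)$ of $\mathcal F_H$ (resp. $\mathcal K_H$) is $J$-optimal (resp. $J$-optimal over $\mathcal K_H$) if $J(\hat{\boldsymbol P}^\ast)\le J(\hat{\boldsymbol P})$ at every point of $\mathcal D_F$ for every $(\boldsymbol K_1,\boldsymbol K_2,\hat{\boldsymbol P})$ in $\mathcal F_H$ (resp. $\mathcal K_H$). *)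

(* Defs.v *)
From mathcomp Require Import all_boot all_order all_algebra.
From mathcomp Require Import reals.

Set Implicit Arguments.
Unset Strict Implicit.
Unset Printing Implicit Defensive.

Import Order.TTheory GRing.Theory Num.Theory.
Local Open Scope ring_scope.

Section Loewner.
Context {R : realType} {m : nat}.
Implicit Types A B : 'M[R]_m.

Definition psdmx A : Prop :=
  A \is symmetricmx /\ forall v : 'cV[R]_m, 0 <= (v^T *m A *m v) 0 0.

Definition pdmx A : Prop :=
  A \is symmetricmx /\ forall v : 'cV[R]_m, v != 0 -> 0 < (v^T *m A *m v) 0 0.

Definition loewner_le A B : Prop := psdmx (B - A).
Definition loewner_lt A B : Prop := pdmx (B - A).

(* A function on the symmetric matrices is represented by a function on all
   square matrices; only its values at symmetric matrices are ever used. *)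
Definition strictly_isotone (J : 'M[R]_m -> R) : Prop :=
  forall A B, A \is symmetricmx -> B \is symmetricmx ->
    (loewner_le A B -> J A <= J B) /\
    (loewner_le A B -> A <> B -> J A < J B).

End Loewner.

Section Fusion.
Context {R : realType} {n p1 p2 : nat}.

Record fusion_input := FusionInput {
  est1 : 'cV[R]_p1;
  est2 : 'cV[R]_p2;
  cov1 : 'M[R]_p1;
  cov2 : 'M[R]_p2;
  cov1_pd : pdmx cov1;
  cov2_pd : pdmx cov2 }.

(* Positive definiteness of the values of [bound] is not built into the type;
   it is part of [conservative_rule]. *)
Record fusion_rule := FusionRule {
  gain1 : fusion_input -> 'M[R]_(n, p1);
  gain2 : fusion_input -> 'M[R]_(n, p2);
  bound : fusion_input -> 'M[R]_n }.

Implicit Types (d : fusion_input) (F G : fusion_rule).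

Definition full_rank_observations (H1 : 'M[R]_(p1, n)) (H2 : 'M[R]_(p2, n))
    : Prop :=
  [/\ \rank H1 = p1, \rank H2 = p2 & \rank (col_mx H1 H2) = n].

Definition unbiased (H1 : 'M[R]_(p1, n)) (H2 : 'M[R]_(p2, n)) F : Prop :=
  forall d, gain1 F d *m H1 + gain2 F d *m H2 = 1%:M.

Definition preserves_conservativeness F : Prop :=
  forall d (P1 : 'M[R]_p1) (P12 : 'M[R]_(p1, p2)) (P2 : 'M[R]_p2),
    let Pjoint := block_mx P1 P12 P12^T P2 in
    let K := row_mx (gain1 F d) (gain2 F d) in
    pdmx Pjoint -> loewner_le P1 (cov1 d) -> loewner_le P2 (cov2 d) ->
    loewner_le (K *m Pjoint *m K^T) (bound F d).

Definition conservative_rule (H1 : 'M[R]_(p1, n)) (H2 : 'M[R]_(p2, n))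
    F : Prop :=
  [/\ forall d, pdmx (bound F d),
      unbiased H1 H2 F
    & preserves_conservativeness F].

Definition info1 (H1 : 'M[R]_(p1, n)) d : 'M[R]_n :=
  H1^T *m invmx (cov1 d) *m H1.
Definition info2 (H2 : 'M[R]_(p2, n)) d : 'M[R]_n :=
  H2^T *m invmx (cov2 d) *m H2.

Definition fused_info (H1 : 'M[R]_(p1, n)) (H2 : 'M[R]_(p2, n))
    (a : R) d : 'M[R]_n :=
  a *: info1 H1 d + (1 - a) *: info2 H2 d.

(* The remaining case, in which the two information matrices are equal, leaves
   [alpha d] arbitrary in [0, 1]. *)
Definition admissible_weight (H1 : 'M[R]_(p1, n)) (H2 : 'M[R]_(p2, n))
    (alpha : fusion_input -> R) : Prop :=
  forall d,
    [/\ 0 <= alpha d <= 1,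
        loewner_lt (info1 H1 d) (info2 H2 d) -> alpha d = 0,
        loewner_lt (info2 H2 d) (info1 H1 d) -> alpha d = 1
      & ~ loewner_lt (info1 H1 d) (info2 H2 d) ->
        info2 H2 d <> info1 H1 d ->
        ~ loewner_lt (info2 H2 d) (info1 H1 d) ->
        fused_info H1 H2 (alpha d) d \in unitmx].

Definition ku_rule (H1 : 'M[R]_(p1, n)) (H2 : 'M[R]_(p2, n))
    (alpha : fusion_input -> R) : fusion_rule :=
  let P d := invmx (fused_info H1 H2 (alpha d) d) in
  {| gain1 := fun d => alpha d *: (P d *m H1^T *m invmx (cov1 d));
     gain2 := fun d => (1 - alpha d) *: (P d *m H2^T *m invmx (cov2 d));
     bound := P |}.

Definition eq_rule F G : Prop :=
  [/\ gain1 F =1 gain1 G, gain2 F =1 gain2 G & bound F =1 bound G].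

Definition kahan_uhlmann (H1 : 'M[R]_(p1, n)) (H2 : 'M[R]_(p2, n)) F : Prop :=
  exists2 alpha, admissible_weight H1 H2 alpha & eq_rule F (ku_rule H1 H2 alpha).

Definition J_optimal_over (J : 'M[R]_n -> R) (S : fusion_rule -> Prop) F : Prop :=
  S F /\ forall G, S G -> forall d, J (bound F d) <= J (bound G d).

End Fusion.

Arguments fusion_input : clear implicits.
Arguments fusion_rule : clear implicits.

(* Main.v *)
Require Import Defs.
From mathcomp Require Import all_boot all_order all_algebra.
From mathcomp Require Import boolp classical_sets reals.
From mathcomp Require Import ring lra.

Set Implicit Arguments.
Unset Strict Implicit.
Unset Printing Implicit Defensive.

Import Order.TTheory GRing.Theory Num.Theory.
Local Open Scope ring_scope.

(** Write [M1], [M2] for the covariance bounds at a point of the domain, and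
[P^a] for the inverse of [fused_info H1 H2 a d].  The theorem follows from the
pointwise fact that every conservative rule is dominated by a member of the
Kahan-Uhlmann family: its bound is at least [P^a] for some admissible [a], and
it can equal [P^a] only if its gains are those of the family.  Choosing such
an [a] at every point yields a Kahan-Uhlmann rule, which is itself
conservative.  Hence, against a [J]-optimal rule, [J] cannot strictly decrease
from its bound to [P^a]; strict isotony forces equality of the bounds, and
then of the gains.  Optimality over the family is inherited from optimality
over all conservative rules.

Domination rests on two facts.

- Letting the cross-covariance vary over everything compatible with [M1] and
  [M2], conservativeness says that a quadratic inequality in [(v, b)] holds
  wherever [b^T M1 b] is at most [v^T K2 M2 K2^T v]: [b] stands for what the
  second error can contribute along the first.  The S-lemma turns this
  one-constraint implication into a multiplier [l] (this is Petersen's lemma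
  on norm-bounded uncertainty), and [a = l / (1 + l)] gives
  [K1 M1 K1^T / a + K2 M2 K2^T / (1 - a) <= P] ([conservative_inflation]).
- By the Gauss-Markov theorem for the inflated covariances [M1 / a] and
  [M2 / (1 - a)], the left-hand side exceeds [P^a] by a sum of squares of the
  deviations of the gains from the Kahan-Uhlmann gains ([gauss_markov2]).

If one of the gains vanishes, the same holds with [a] equal to 0 or 1 and a
single sensor ([gauss_markov1]).  The weight so obtained may fail to be
admissible only when one information matrix strictly dominates the other;
moving it to the prescribed endpoint then increases the fused information and
so improves the bound ([admissible_dominating_weight]).

That the family is conservative is the convexity of the quadratic form of the
joint covariance ([ku_conservative]). *)

(** * Bilinear forms of matrices *)

Section BilinearForms.
Context {R : realType}.

Definition bform m k (A : 'M[R]_(m, k)) (u : 'cV_m) (v : 'cV_k) : R :=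
  (u^T *m A *m v) 0 0.

Lemma symmxE m (A : 'M[R]_m) : (A \is symmetricmx) = (A == A^T).
Proof. by rewrite is_hermitianmxE expr0 scale1r map_mx_id. Qed.

Lemma symmxP m (A : 'M[R]_m) : reflect (A^T = A) (A \is symmetricmx).
Proof. by rewrite symmxE eq_sym; apply: eqP. Qed.

Lemma formDl m k (A : 'M[R]_(m, k)) u1 u2 v :
  bform A (u1 + u2) v = bform A u1 v + bform A u2 v.
Proof. by rewrite /bform linearD /= !mulmxDl mxE. Qed.

Lemma formZl m k (A : 'M[R]_(m, k)) a u v : bform A (a *: u) v = a * bform A u v.
Proof. by rewrite /bform linearZ /= -!scalemxAl mxE. Qed.

Lemma formDr m k (A : 'M[R]_(m, k)) u v1 v2 :
  bform A u (v1 + v2) = bform A u v1 + bform A u v2.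
Proof. by rewrite /bform !mulmxDr mxE. Qed.

Lemma formZr m k (A : 'M[R]_(m, k)) a u v : bform A u (a *: v) = a * bform A u v.
Proof. by rewrite /bform -!scalemxAr mxE. Qed.

Lemma formDm m k (A B : 'M[R]_(m, k)) u v :
  bform (A + B) u v = bform A u v + bform B u v.
Proof. by rewrite /bform mulmxDr mulmxDl mxE. Qed.

Lemma formZm m k (A : 'M[R]_(m, k)) a u v : bform (a *: A) u v = a * bform A u v.
Proof. by rewrite /bform -scalemxAr -scalemxAl mxE. Qed.

Lemma formNm m k (A : 'M[R]_(m, k)) u v : bform (- A) u v = - bform A u v.
Proof. by rewrite -scaleN1r formZm mulN1r. Qed.

Lemma formBm m k (A B : 'M[R]_(m, k)) u v :
  bform (A - B) u v = bform A u v - bform B u v.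
Proof. by rewrite formDm formNm. Qed.

Lemma form0l m k (A : 'M[R]_(m, k)) v : bform A 0 v = 0.
Proof. by rewrite -(scale0r 0) formZl mul0r. Qed.

Lemma form0r m k (A : 'M[R]_(m, k)) u : bform A u 0 = 0.
Proof. by rewrite -(scale0r 0) formZr mul0r. Qed.

Lemma form_tr m k (A : 'M[R]_(m, k)) u v : bform A^T u v = bform A v u.
Proof.
have -> : bform A v u = (v^T *m A *m u)^T 0 0 by rewrite [RHS]mxE.
by rewrite !trmx_mul trmxK mulmxA.
Qed.

Lemma formC m (A : 'M[R]_m) u v : A \is symmetricmx -> bform A u v = bform A v u.
Proof. by move/symmxP=> {1}<-; apply: form_tr. Qed.

Lemma form_mull m k l (A : 'M[R]_(m, k)) (B : 'M[R]_(k, l)) u v :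
  bform (A *m B) u v = bform B (A^T *m u) v.
Proof. by rewrite /bform trmx_mul trmxK !mulmxA. Qed.

Lemma form_mulr m k l (A : 'M[R]_(m, k)) (B : 'M[R]_(k, l)) u v :
  bform (A *m B) u v = bform A u (B *m v).
Proof. by rewrite /bform !mulmxA. Qed.

Lemma form_conj m k (K : 'M[R]_(m, k)) (S : 'M[R]_k) u v :
  bform (K *m S *m K^T) u v = bform S (K^T *m u) (K^T *m v).
Proof. by rewrite form_mulr form_mull. Qed.

Lemma form_block m k (A : 'M[R]_m) (B : 'M[R]_(m, k)) (D : 'M[R]_k) a c b d :
  bform (block_mx A B B^T D) (col_mx a c) (col_mx b d) =
  bform A a b + bform B a d + bform B b c + bform D c d.
Proof.
rewrite -(form_tr B c b) /bform tr_col_mx mul_row_block mul_row_col !mulmxDl.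
have addE (X Y : 'M[R]_1) : (X + Y) 0 0 = X 0 0 + Y 0 0 by rewrite mxE.
by rewrite !addE; ring.
Qed.

Lemma form_delta m k (A : 'M[R]_(m, k)) i v :
  bform A (delta_mx i 0) v = (A *m v) i 0.
Proof. by rewrite /bform trmx_delta -mulmxA -rowE mxE. Qed.

Lemma form_inj m k (A B : 'M[R]_(m, k)) :
  (forall u v, bform A u v = bform B u v) -> A = B.
Proof.
move=> AB; apply/matrixP=> i j.
by have := AB (delta_mx i 0) (delta_mx j 0); rewrite !form_delta -!colE !mxE.
Qed.

Lemma form_sqrD m (A : 'M[R]_m) u v t : A \is symmetricmx ->
  bform A (u + t *: v) (u + t *: v) =
  bform A u u + t * (2 * bform A u v) + t ^+ 2 * bform A v v.
Proof.
by move=> sA; rewrite !(formDl, formDr, formZl, formZr) (formC v u sA); ring.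
Qed.

End BilinearForms.

(** * Semidefinite matrices and the Loewner order *)

Section Definiteness.
Context {R : realType}.

Lemma psd_ge0 m (A : 'M[R]_m) v : psdmx A -> 0 <= bform A v v.
Proof. by case=> _; apply. Qed.

Lemma pd_gt0 m (A : 'M[R]_m) v : pdmx A -> v != 0 -> 0 < bform A v v.
Proof. by case=> _; apply. Qed.

Lemma pd_psd m (A : 'M[R]_m) : pdmx A -> psdmx A.
Proof.
case=> sA pA; split=> // v; case: (eqVneq v 0) => [->|/pA/ltW//].
by rewrite mulmx0 mxE.
Qed.

Lemma symD m (A B : 'M[R]_m) :
  A \is symmetricmx -> B \is symmetricmx -> A + B \is symmetricmx.
Proof. by move=> /symmxP sA /symmxP sB; apply/symmxP; rewrite linearD /= sA sB. Qed.

Lemma symZ m (A : 'M[R]_m) a : A \is symmetricmx -> a *: A \is symmetricmx.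
Proof. by move=> /symmxP sA; apply/symmxP; rewrite linearZ /= sA. Qed.

Lemma symB m (A B : 'M[R]_m) :
  A \is symmetricmx -> B \is symmetricmx -> A - B \is symmetricmx.
Proof. by move=> sA sB; rewrite -scaleN1r; apply/symD/symZ. Qed.

Lemma sym_conj m k (K : 'M[R]_(m, k)) (S : 'M[R]_k) :
  S \is symmetricmx -> K *m S *m K^T \is symmetricmx.
Proof.
by move=> /symmxP sS; apply/symmxP; rewrite !trmx_mul trmxK sS mulmxA.
Qed.

Lemma sym_inv m (A : 'M[R]_m) :
  A \is symmetricmx -> invmx A \is symmetricmx.
Proof. by move=> /symmxP sA; apply/symmxP; rewrite trmx_inv sA. Qed.

Lemma psd_conj m k (K : 'M[R]_(m, k)) (S : 'M[R]_k) :
  psdmx S -> psdmx (K *m S *m K^T).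
Proof.
move=> pS; split; first by apply: sym_conj; case: pS.
by move=> v; rewrite -/(bform _ v v) form_conj; apply: psd_ge0.
Qed.

Lemma psdD m (A B : 'M[R]_m) : psdmx A -> psdmx B -> psdmx (A + B).
Proof.
move=> pA pB; split; first by apply: symD; [case: pA|case: pB].
by move=> v; rewrite -/(bform _ v v) formDm addr_ge0 ?psd_ge0.
Qed.

Lemma psdZ m (A : 'M[R]_m) a : 0 <= a -> psdmx A -> psdmx (a *: A).
Proof.
move=> a0 pA; split; first by apply: symZ; case: pA.
by move=> v; rewrite -/(bform _ v v) formZm mulr_ge0 ?psd_ge0.
Qed.

Lemma loewner_trans m (B A C : 'M[R]_m) :
  loewner_le A B -> loewner_le B C -> loewner_le A C.
Proof.
by move=> AB BC; have := psdD BC AB; rewrite /loewner_le addrA subrK.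
Qed.

(** A symmetric matrix whose quadratic form vanishes is zero, by polarisation. *)
Lemma loewner_anti m (A B : 'M[R]_m) :
  loewner_le A B -> loewner_le B A -> A = B.
Proof.
move=> AB BA; apply/eqP; rewrite -subr_eq0; apply/eqP.
have q0 v : bform (A - B) v v = 0.
  apply/le_anti; rewrite (psd_ge0 v BA) andbT.
  by rewrite -opprB formNm oppr_le0 (psd_ge0 v AB).
have sAB : A - B \is symmetricmx by case: BA.
apply: form_inj => u v; have := form_sqrD u v 1 sAB.
have -> : bform 0 u v = 0 by rewrite /bform mulmx0 mul0mx mxE.
rewrite !q0; lra.
Qed.

(** If [bform A u v] were nonzero, the form would be negative at some
    [u + t *: v], being affine in [t]. *)
Lemma psd_kernel m (A : 'M[R]_m) v : psdmx A -> bform A v v = 0 -> A *m v = 0.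
Proof.
move=> pA v0; apply/matrixP=> i j; rewrite ord1 -form_delta mxE.
set u := delta_mx i 0; apply: contrapT => /eqP b0.
have sA : A \is symmetricmx by case: pA.
set b := bform A u v in b0 *.
set t := - (bform A u u + 1) / (2 * b).
have := psd_ge0 (u + t *: v) pA; rewrite form_sqrD // v0 -/b.
have -> : t * (2 * b) = - (bform A u u + 1) by rewrite /t; field.
lra.
Qed.

Lemma ker0_unit m (A : 'M[R]_m) : (forall v : 'cV_m, A *m v = 0 -> v = 0) ->
  A \in unitmx.
Proof.
move=> kA; rewrite -unitmx_tr -row_free_unit; apply: inj_row_free => v vA.
apply: trmx_inj; rewrite trmx0; apply: kA.
by rewrite -[A]trmxK -trmx_mul vA trmx0.
Qed.

Lemma pd_unit m (A : 'M[R]_m) : pdmx A -> A \in unitmx.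
Proof.
move=> pA; apply: ker0_unit => v Av; apply: contraTeq isT => /(pd_gt0 pA).
by rewrite /bform -mulmxA Av mulmx0 mxE ltxx.
Qed.

Lemma psd_unit_pd m (A : 'M[R]_m) : psdmx A -> A \in unitmx -> pdmx A.
Proof.
move=> pA uA; split=> [|v v0]; first by case: pA.
rewrite -/(bform A v v) lt_neqAle psd_ge0 // andbT eq_sym.
apply: contraNneq v0 => /(psd_kernel pA) Av.
by rewrite -(mulKmx uA v) Av mulmx0.
Qed.

Lemma pd_inv m (A : 'M[R]_m) : pdmx A -> pdmx (invmx A).
Proof.
move=> pA; have uA := pd_unit pA; have sA : A \is symmetricmx by case: pA.
apply: psd_unit_pd; last by rewrite unitmx_inv.
have := psd_conj (invmx A) (pd_psd pA).
by rewrite mulVmx // mul1mx trmx_inv (symmxP _ sA).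
Qed.

Lemma loewner_lt_pd m (A B : 'M[R]_m) : psdmx A -> loewner_lt A B -> pdmx B.
Proof.
move=> pA [sBA pBA]; have sA : A \is symmetricmx by case: pA.
split=> [|v v0]; first by rewrite -(subrK A B); apply: symD.
have := pBA v v0; rewrite -!/(bform _ v v) formBm.
by have := psd_ge0 v pA; lra.
Qed.

(** With [u := invmx A *m w] and [z := invmx B *m w], expanding
    [0 <= bform A (u - z) (u - z)] gives
    [2 w^T z <= w^T u + bform A z z <= w^T u + w^T z]. *)
Lemma loewner_inv m (A B : 'M[R]_m) : pdmx A -> pdmx B ->
  loewner_le A B -> loewner_le (invmx B) (invmx A).
Proof.
move=> pA pB AB; have [sA sB] : A \is symmetricmx /\ B \is symmetricmx.
  by case: pA; case: pB.
split; first by apply: symB; apply: sym_inv.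
move=> w; rewrite -/(bform _ w w) formBm.
set u := invmx A *m w; set z := invmx B *m w.
have wA : w = A *m u by rewrite mulKVmx // pd_unit.
have wB : w = B *m z by rewrite mulKVmx // pd_unit.
have eA x : bform A x u = bform 1%:M x w by rewrite wA -form_mulr mul1mx.
have eB x : bform B x z = bform 1%:M x w by rewrite wB -form_mulr mul1mx.
have s1 : (1%:M : 'M[R]_m) \is symmetricmx by apply/symmxP; rewrite trmx1.
have -> : bform (invmx A) w w = bform 1%:M u w.
  by rewrite (formC _ _ s1) -form_mulr mul1mx.
have -> : bform (invmx B) w w = bform 1%:M z w.
  by rewrite (formC _ _ s1) -form_mulr mul1mx.
have := psd_ge0 (u + (-1) *: z) (pd_psd pA).
have := psd_ge0 z AB; rewrite formBm eB form_sqrD // (formC u) // !eA; lra.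
Qed.

Lemma form_invK m (A : 'M[R]_m) x : pdmx A ->
  bform A (invmx A *m x) (invmx A *m x) = bform (invmx A) x x.
Proof.
move=> pA; have sA : A \is symmetricmx by case: pA.
rewrite -form_mulr mulmxV ?pd_unit // -form_tr trmx1.
by rewrite -form_mulr mul1mx.
Qed.

End Definiteness.

(** * The S-lemma *)

Section SLemma.
Context {R : realType}.
Local Open Scope classical_set_scope.

(** Being quadratic along every line is all that the S-lemma uses, and it lets
    forms on a product space be given without block matrices. *)
Definition quadratic (V : lmodType R) (f : V -> R) : Prop :=
  exists b : V -> V -> R,
    forall z w t, f (z + t *: w) = f z + t * b z w + t ^+ 2 * f w.

(** On the line through [z] with direction [w] the form [f] changes sign, so it
    has roots [t1 < 0 < t2] with [t1 * t2 = f z / f w], where [g] is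
    nonnegative.  Weighting the two inequalities on [g] by [t2] and [- t1]
    cancels its linear term and leaves [g z - t1 * t2 * g w >= 0]. *)
Lemma S_lemma_slopes (V : lmodType R) (f g : V -> R) z w :
    quadratic f -> quadratic g -> (forall x, 0 <= f x -> 0 <= g x) ->
  f z < 0 -> 0 < f w -> f z * g w <= f w * g z.
Proof.
move=> [bf qf] [bg qg] fg; set a := f z; set c := f w; set b := bf z w => a0 c0.
set s := Num.sqrt (b ^+ 2 - 4 * a * c).
have s2 : s ^+ 2 = b ^+ 2 - 4 * a * c by rewrite sqr_sqrtr //; nra.
have s0 : 0 <= s by apply: sqrtr_ge0.
have sb : b < s by nra.
have sNb : - b < s by nra.
pose t1 := (- b - s) / (2 * c); pose t2 := (- b + s) / (2 * c).
have t1n : t1 < 0 by rewrite pmulr_llt0 ?invr_gt0; lra.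
have t2p : 0 < t2 by apply: divr_gt0; lra.
have c_neq0 : c != 0 by rewrite gt_eqF.
have t12 : t1 * t2 = a / c.
  have -> : t1 * t2 = (b ^+ 2 - s ^+ 2) / (4 * c ^+ 2).
    by rewrite /t1 /t2; field.
  by rewrite s2; field.
have root t : (2 * c * t + b) ^+ 2 = s ^+ 2 -> 0 <= g z + t * bg z w + t ^+ 2 * g w.
  move=> tP; rewrite -qg; apply: fg; rewrite qf -/a -/b -/c.
  suff -> : a + t * b + t ^+ 2 * c = 0 by [].
  apply: (mulfI (x := 4 * c)); first by rewrite mulf_neq0 ?pnatr_eq0.
  rewrite mulr0; move: tP; rewrite s2 => tP; lra.
have g1 := root t1; have g2 := root t2.
have {}g1 : 0 <= t2 * (g z + t1 * bg z w + t1 ^+ 2 * g w).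
  by apply: mulr_ge0; [exact: ltW|apply: g1; rewrite /t1; field].
have {}g2 : 0 <= - t1 * (g z + t2 * bg z w + t2 ^+ 2 * g w).
  by apply: mulr_ge0; [lra|apply: g2; rewrite /t2; field].
have : 0 <= (t2 - t1) * (g z - t1 * t2 * g w) by lra.
rewrite pmulr_rge0; last by lra.
rewrite t12 -(pmulr_rge0 _ c0).
have -> : c * (g z - a / c * g w) = c * g z - a * g w by field.
by rewrite subr_ge0.
Qed.

(** The multiplier must lie below all [g x / f x] with [f x > 0] and above all
    those with [f x < 0]; [S_lemma_slopes] says that these two sets of slopes
    are separated, so the infimum of the first one works. *)
Lemma S_lemma (V : lmodType R) (f g : V -> R) w0 :
    quadratic f -> quadratic g -> 0 < f w0 ->
    (forall x, 0 <= f x -> 0 <= g x) ->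
  exists2 l, 0 <= l & forall x, l * f x <= g x.
Proof.
move=> qf qg w0P fg.
pose E := [set x | exists2 w, 0 < f w & x = g w / f w].
have E0 : E !=set0 by exists (g w0 / f w0), w0.
have E_ge0 : lbound E 0.
  by move=> _ [w fw ->]; rewrite divr_ge0 ?fg ?ltW.
exists (inf E); first exact: lb_le_inf.
move=> x; have [fx|fx|fx] := ltgtP 0 (f x); last 1 first.
- by rewrite -fx mulr0 fg // -fx.
- rewrite -ler_pdivlMr //; apply: ge_inf; first by exists 0.
  by exists x.
- rewrite -ler_ndivrMr //; apply: lb_le_inf => // _ [w fw ->].
  rewrite ler_ndivrMr // mulrAC ler_pdivrMr // mulrC [leRHS]mulrC.
  exact: S_lemma_slopes.
Qed.

End SLemma.

(** * Unknown cross-covariances and Petersen's lemma *)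

Section Petersen.
Context {R : realType}.

Lemma form_CS m (A : 'M[R]_m) u v : psdmx A ->
  bform A u v ^+ 2 <= bform A u u * bform A v v.
Proof.
move=> pA; have sA : A \is symmetricmx by case: pA.
have [v0|v0] := eqVneq (bform A v v) 0.
  have -> : bform A u v = 0.
    by rewrite /bform -mulmxA (psd_kernel pA v0) mulmx0 mxE.
  by rewrite v0 mulr0 expr0n.
have vv : 0 < bform A v v by rewrite lt_neqAle eq_sym v0 psd_ge0.
have := psd_ge0 (u + (- (bform A u v / bform A v v)) *: v) pA.
rewrite form_sqrD // => /(mulr_ge0 (ltW vv)) ge0; rewrite -subr_ge0.
apply: le_trans ge0 _; rewrite le_eqVlt; apply/orP; left; apply/eqP.
by field.
Qed.

Lemma form_rank1 m k (A : 'M[R]_m) (D : 'M[R]_k) b c u v :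
  bform (A *m b *m (c^T *m D)) u v = bform A u b * bform D c v.
Proof.
rewrite /bform.
have -> : u^T *m (A *m b *m (c^T *m D)) *m v
          = (u^T *m A *m b) *m (c^T *m D *m v) by rewrite !mulmxA.
by rewrite [LHS]mxE big_ord1.
Qed.

Lemma form_joint n m k (K1 : 'M[R]_(n, m)) (K2 : 'M[R]_(n, k)) A B D v :
    A \is symmetricmx -> D \is symmetricmx ->
  bform (row_mx K1 K2 *m block_mx A B B^T D *m (row_mx K1 K2)^T) v v =
  bform A (K1^T *m v) (K1^T *m v) + 2 * bform B (K1^T *m v) (K2^T *m v)
  + bform D (K2^T *m v) (K2^T *m v).
Proof.
by move=> sA sD; rewrite form_conj tr_row_mx mul_col_mx form_block; ring.
Qed.

(** The extremal correlation aligns the second error along [y] with [b]: it is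
    the rank-one matrix sending [y] to [t *: (A *m b)].  The constraint on [b]
    makes it a contraction in the norms given by [A] and [D], and [t < 1] keeps
    the joint covariance positive definite. *)
Lemma cross_covariance m k (A : 'M[R]_m) (D : 'M[R]_k) b y t :
    pdmx A -> pdmx D -> 0 <= t < 1 -> bform A b b <= bform D y y ->
  exists2 B, pdmx (block_mx A B B^T D)
    & forall x, bform B x y = t * bform A x b.
Proof.
move=> pA pD /andP[t0 t1] Nb; set N := bform D y y in Nb.
have [sA sD] : A \is symmetricmx /\ D \is symmetricmx by case: pA; case: pD.
(* When [y = 0], also [b = 0], and [t / N = 0] gives the zero matrix. *)
exists ((t / N) *: (A *m b *m (y^T *m D))); last first.
  move=> x; rewrite formZm form_rank1 -/N.
  have [y0|/(pd_gt0 pD) y0] := eqVneq y 0; last first.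
    by field; rewrite gt_eqF.
  have -> : b = 0.
    apply: contraTeq Nb => /(pd_gt0 pA).
    by rewrite -ltNge /N y0 form0l.
  by rewrite form0r !(mulr0, mul0r).
split.
  by apply/symmxP; rewrite tr_block_mx trmxK (symmxP _ sA) (symmxP _ sD).
move=> z z0; rewrite -/(bform _ z z) -[z]vsubmxK.
set a := usubmx z; set c := dsubmx z; rewrite form_block formZm form_rank1.
set al := bform A a a; set ga := bform D c c.
have al0 : 0 <= al by apply/psd_ge0/pd_psd.
have ga0 : 0 <= ga by apply/psd_ge0/pd_psd.
have alga : 0 < al + ga.
  have [a0|/(pd_gt0 pA)] := eqVneq a 0; last by rewrite -/al; lra.
  have : c != 0.
    apply: contraNneq z0 => c0; rewrite -[z]vsubmxK -/a -/c a0 c0.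
    by rewrite col_mx0.
  by move/(pd_gt0 pD); rewrite -/ga; lra.
set s := N^-1 * (bform A a b * bform D y c).
have s2 : s ^+ 2 <= al * ga.
  have N0 : 0 <= N by apply/psd_ge0/pd_psd.
  have ab := form_CS a b (pd_psd pA); have yc := form_CS y c (pd_psd pD).
  have [Nz|Nz] := eqVneq N 0.
    by rewrite /s Nz invr0 mul0r expr0n mulr_ge0.
  have Np : 0 < N ^+ 2 by rewrite exprn_gt0 // lt_neqAle eq_sym Nz.
  rewrite -(ler_pM2l Np).
  have -> : N ^+ 2 * s ^+ 2 = bform A a b ^+ 2 * bform D y c ^+ 2.
    by rewrite /s; field.
  apply: (@le_trans _ _ ((al * bform A b b) * (N * ga))).
    by apply: ler_pM; rewrite ?sqr_ge0.
  have -> : N ^+ 2 * (al * ga) = (al * N) * (N * ga) by ring.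
  by rewrite ler_wpM2r ?mulr_ge0 // ler_wpM2l.
have sB : - (al + ga) <= 2 * s.
  rewrite leNgt; apply/negP => lt_s.
  have : 0 < (- (al + ga) - 2 * s) * (al + ga - 2 * s) by apply: mulr_gt0; lra.
  have := sqr_ge0 (al - ga); lra.
have -> : al + t / N * (bform A a b * bform D y c)
  + t / N * (bform A a b * bform D y c) + ga = al + ga + t * (2 * s).
  by rewrite /s; ring.
nra.
Qed.

Lemma nonzero_tr_mulmx m k (K : 'M[R]_(m, k)) :
  K != 0 -> exists v : 'cV_m, K^T *m v != 0.
Proof.
move=> K0; apply: contrapT => noV; case/eqP: K0; apply: trmx_inj.
rewrite trmx0; apply/matrixP=> i j; rewrite [RHS]mxE.
have -> : K^T i j = (K^T *m delta_mx j 0 : 'cV_k) i 0 by rewrite -colE !mxE.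
apply: contrapT => Kj; apply: noV; exists (delta_mx j 0).
by apply/eqP => Kj0; apply: Kj; rewrite Kj0 mxE.
Qed.

(** Petersen's lemma.  Conservativeness against all admissible
    cross-covariances is an implication between two quadratic forms in
    [(v, b)], to which the S-lemma applies; eliminating [b] from the resulting
    inequality at its minimiser leaves the claim. *)
Lemma conservative_inflation n m k (K1 : 'M[R]_(n, m)) (K2 : 'M[R]_(n, k))
    (M1 : 'M[R]_m) (M2 : 'M[R]_k) (P : 'M[R]_n) :
    pdmx M1 -> pdmx M2 -> P \is symmetricmx -> K1 != 0 -> K2 != 0 ->
    (forall B, pdmx (block_mx M1 B B^T M2) ->
      loewner_le (row_mx K1 K2 *m block_mx M1 B B^T M2 *m (row_mx K1 K2)^T) P) ->
  exists2 a, 0 < a < 1 &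
    loewner_le (a^-1 *: (K1 *m M1 *m K1^T) + (1 - a)^-1 *: (K2 *m M2 *m K2^T)) P.
Proof.
move=> pM1 pM2 sP K1n0 K2n0 cons.
have [sM1 sM2] : M1 \is symmetricmx /\ M2 \is symmetricmx by case: pM1; case: pM2.
pose q1 v := bform M1 (K1^T *m v) (K1^T *m v).
pose q2 v := bform M2 (K2^T *m v) (K2^T *m v).
pose D v := bform P v v - q1 v - q2 v.
pose f (z : 'cV[R]_n * 'cV[R]_m) := q2 z.1 - bform M1 z.2 z.2.
pose g (z : 'cV[R]_n * 'cV[R]_m) := D z.1 - 2 * bform M1 (K1^T *m z.1) z.2.
have gap v b t : 0 <= t < 1 -> bform M1 b b <= q2 v ->
    2 * t * bform M1 (K1^T *m v) b <= D v.
  move=> t01 bv; have [B pB Bt] := cross_covariance pM1 pM2 t01 bv.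
  have := psd_ge0 v (cons B pB).
  by rewrite formBm form_joint // Bt /D /q1 /q2; lra.
have fg z : 0 <= f z -> 0 <= g z.
  case: z => v b; rewrite /f /g /= !subr_ge0 => bv.
  set q := bform M1 _ b.
  have D0 : 0 <= D v.
    by have := gap v b 0; rewrite lexx ltr01 mulr0 mul0r; apply.
  (* Let the correlation [t] tend to 1: a gap would show at the [t] for which
     [2 * t * q] is midway between [D v] and [2 * q]. *)
  rewrite leNgt; apply/negP => Dq.
  have q0 : 0 < q by lra.
  have := gap v b ((D v / (2 * q) + 1) / 2) _ bv.
  rewrite -/q.
  have -> : 2 * ((D v / (2 * q) + 1) / 2) * q = (D v + 2 * q) / 2.
    by field; rewrite gt_eqF.
  have Dq0 : 0 <= D v / (2 * q) by rewrite divr_ge0 //; lra.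
  have Dq1 : D v / (2 * q) < 1 by rewrite ltr_pdivrMr; lra.
  move=> H; have : (D v + 2 * q) / 2 <= D v by apply: H; lra.
  lra.
have qf : quadratic f.
  exists (fun z w => 2 * bform M2 (K2^T *m z.1) (K2^T *m w.1)
                     - 2 * bform M1 z.2 w.2) => -[z1 z2] [w1 w2] t.
  by rewrite /f /q2 /= mulmxDr -scalemxAr !form_sqrD //; ring.
have qg : quadratic g.
  exists (fun z w => 2 * bform P z.1 w.1
     - 2 * bform M1 (K1^T *m z.1) (K1^T *m w.1)
     - 2 * bform M2 (K2^T *m z.1) (K2^T *m w.1)
     - 2 * bform M1 (K1^T *m z.1) w.2
     - 2 * bform M1 (K1^T *m w.1) z.2) => -[z1 z2] [w1 w2] t.
  rewrite /g /D /q1 /q2 /= !mulmxDr -!scalemxAr !form_sqrD //.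
  by rewrite !(formDl, formDr, formZl, formZr); ring.
have [v2 v2P] := nonzero_tr_mulmx K2n0.
have fv2 : 0 < f (v2, 0) by rewrite /f /= form0l subr0; apply: pd_gt0.
have [l l0 lP] := S_lemma qf qg fv2 fg.
(* With a zero multiplier, [g] would be nonnegative everywhere, although it is
   affine in [b], with slope nonzero once [K1^T *m v] is. *)
have {}l0 : 0 < l.
  rewrite lt_neqAle l0 andbT; apply/negP => /eqP l0'.
  have [v v0] := nonzero_tr_mulmx K1n0; have q0 := pd_gt0 pM1 v0.
  have := lP (v, ((D v + 1) / (2 * q1 v)) *: (K1^T *m v)).
  rewrite -l0' mul0r /g /= formZr -/(q1 v).
  have -> : 2 * ((D v + 1) / (2 * q1 v) * q1 v) = D v + 1.
    by field; rewrite gt_eqF.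
  lra.
have l1 : 0 < 1 + l by lra.
exists (l / (1 + l)).
  by rewrite divr_gt0 //= ltr_pdivrMr // mul1r ltrDr ltr01.
have -> : (l / (1 + l))^-1 = 1 + l^-1 by field; rewrite !gt_eqF.
have -> : (1 - l / (1 + l))^-1 = 1 + l.
  have -> : 1 - l / (1 + l) = (1 + l)^-1 by field; rewrite gt_eqF.
  by rewrite invrK.
split.
  by apply: symB => //; apply: symD; apply: symZ; apply: sym_conj.
move=> v; rewrite -/(bform _ v v) formBm formDm !formZm !form_conj.
rewrite -/(q1 v) -/(q2 v).
(* [b = l^-1 *: (K1^T *m v)] minimises [g - l * f] in [b]. *)
have := lP (v, l^-1 *: (K1^T *m v)); rewrite /f /g /= formZr !formZl formZr.
rewrite -/(q1 v) mulrBr.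
have -> : l * (l^-1 * (l^-1 * q1 v)) = l^-1 * q1 v by field; rewrite gt_eqF.
rewrite /D; lra.
Qed.

End Petersen.

(** * The Gauss-Markov bound *)

Section GaussMarkov.
Context {R : realType}.

(** [info] and [fusion] are the matrix-level counterparts of [info1], [info2]
    and [fused_info], convertible to them, so that the results on one sensor
    serve both. *)
Definition info n m (H : 'M[R]_(m, n)) (M : 'M[R]_m) : 'M[R]_n :=
  H^T *m invmx M *m H.

Definition fusion n m k (H1 : 'M[R]_(m, n)) (H2 : 'M[R]_(k, n)) M1 M2 (a : R) :=
  a *: info H1 M1 + (1 - a) *: info H2 M2.

Lemma form_info n m (H : 'M[R]_(m, n)) M v :
  bform (info H M) v v = bform (invmx M) (H *m v) (H *m v).
Proof. by rewrite /info form_mulr form_mull trmxK. Qed.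

Lemma psd_info n m (H : 'M[R]_(m, n)) M : pdmx M -> psdmx (info H M).
Proof.
move=> /pd_inv pM; rewrite /info -{2}[H]trmxK.
exact/psd_conj/pd_psd.
Qed.

Lemma info_ker n m (H : 'M[R]_(m, n)) M v : pdmx M ->
  bform (info H M) v v = 0 -> H *m v = 0.
Proof.
move=> /pd_inv pM; rewrite form_info => Hv0.
by have [//|/(pd_gt0 pM)] := eqVneq (H *m v) 0; rewrite Hv0 ltxx.
Qed.

Lemma pd_info n m (H : 'M[R]_(m, n)) M : pdmx M ->
  (forall v : 'cV_n, H *m v = 0 -> v = 0) -> pdmx (info H M).
Proof.
move=> pM Hinj; split; first by case: (psd_info H pM).
move=> v v0; rewrite -/(bform _ v v) lt_neqAle psd_ge0 ?andbT; last exact: psd_info.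
by rewrite eq_sym; apply: contraNneq v0 => /(info_ker pM)/Hinj ->.
Qed.

Lemma pd_conj_eq0 n m (K : 'M[R]_(n, m)) S : pdmx S -> K *m S *m K^T = 0 -> K = 0.
Proof.
move=> pS KSK; have [//|/nonzero_tr_mulmx[v /(pd_gt0 pS)]] := eqVneq K 0.
rewrite -form_conj KSK.
by rewrite /bform mulmx0 mul0mx mxE ltxx.
Qed.

Lemma psd_add_eq0 m (A B : 'M[R]_m) : psdmx A -> psdmx B -> A + B = 0 -> A = 0.
Proof.
move=> pA pB AB; apply: loewner_anti; last by rewrite /loewner_le subr0.
by rewrite /loewner_le sub0r (addr0_eq AB).
Qed.

(** Completing the square around [L], the optimal gain of a sensor whose
    covariance [S] is inflated by [c^-1].  The cross terms only involve
    [K *m H], so after summation over the sensors unbiasedness turns them into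
    [T]. *)
Lemma gain_deviation n m (H : 'M[R]_(m, n)) S (K : 'M[R]_(n, m)) T c :
    pdmx S -> T \is symmetricmx -> c != 0 ->
  let L := c *: (T *m H^T *m invmx S) in
  c^-1 *: ((K - L) *m S *m (K - L)^T) =
  c^-1 *: (K *m S *m K^T) - K *m H *m T - T *m (K *m H)^T
  + T *m (c *: info H S) *m T.
Proof.
move=> pS /symmxP sT c0 L; have uS := pd_unit pS.
have sS : S^T = S by apply/symmxP; case: pS.
have LS : L *m S = c *: (T *m H^T) by rewrite /L -scalemxAl mulmxKV.
have SL : S *m L^T = c *: (H *m T).
  by rewrite -[LHS]trmxK trmx_mul trmxK sS LS linearZ /= trmx_mul trmxK sT.
have -> : (K - L) *m S *m (K - L)^T
  = K *m S *m K^T - K *m (S *m L^T) - (L *m S) *m K^T + (L *m S) *m L^T.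
  by rewrite linearB /= 2!mulmxBl !mulmxBr !mulmxA opprB addrA addrAC.
rewrite SL LS !scalerDr !scalerN -!scalemxAr -!scalemxAl !scalerA mulVf // !scale1r.
rewrite trmx_mul /info /L linearZ /= trmx_mul trmx_inv sS trmx_mul trmxK sT.
by rewrite -!scalemxAr !mulmxA.
Qed.

Lemma gauss_markov1 n m (H : 'M[R]_(m, n)) M (K : 'M[R]_(n, m)) P :
    pdmx M -> K *m H = 1%:M -> loewner_le (K *m M *m K^T) P ->
  [/\ pdmx (info H M), loewner_le (invmx (info H M)) P
    & P = invmx (info H M) -> K = invmx (info H M) *m H^T *m invmx M].
Proof.
move=> pM KH KP; have pI : pdmx (info H M).
  by apply: pd_info => // v Hv; rewrite -[v]mul1mx -KH -mulmxA Hv mulmx0.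
set T := invmx _; have sT : T \is symmetricmx by case: (pd_inv pI).
have := gain_deviation H K pM sT (oner_neq0 R).
rewrite /= invr1 !scale1r KH trmx1 mulmx1 mul1mx.
rewrite (mulVmx (pd_unit pI)) mul1mx subrK.
set L := T *m _ *m _ => dev.
have le_T : loewner_le T (K *m M *m K^T).
  by rewrite /loewner_le -dev; apply/psd_conj/pd_psd.
split=> //; first exact: loewner_trans KP.
move=> PT; apply/eqP; rewrite -subr_eq0; apply/eqP; apply: pd_conj_eq0 pM _.
by rewrite dev; apply/eqP; rewrite subr_eq0; apply/eqP/loewner_anti; rewrite // -PT.
Qed.

Lemma pd_fusion n m k (H1 : 'M[R]_(m, n)) (H2 : 'M[R]_(k, n)) M1 M2 a :
    pdmx M1 -> pdmx M2 -> \rank (col_mx H1 H2) = n -> 0 < a < 1 ->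
  pdmx (fusion H1 H2 M1 M2 a).
Proof.
move=> pM1 pM2 rH /andP[a0 a1].
have [pI1 pI2] := (psd_info H1 pM1, psd_info H2 pM2).
split; first by case: (psdD (psdZ (ltW a0) pI1) (psdZ (ltW _ : 0 <= 1 - a) pI2));
  rewrite ?subr_gt0.
move=> v v0; rewrite -/(bform _ v v) formDm !formZm.
have [i1 i2] := (psd_ge0 v pI1, psd_ge0 v pI2).
rewrite lt_neqAle eq_sym addr_ge0 ?andbT ?mulr_ge0 //; last 2 first.
- exact: ltW.
- by rewrite subr_ge0 ltW.
apply: contraNneq v0 => sum0.
have H1v : H1 *m v = 0 by apply: (info_ker pM1); nra.
have H2v : H2 *m v = 0 by apply: (info_ker pM2); nra.
have /row_fullP[L LH] : row_full (col_mx H1 H2) by rewrite /row_full rH.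
by rewrite -[v]mul1mx -LH -mulmxA mul_col_mx H1v H2v col_mx0 mulmx0.
Qed.

Lemma gauss_markov2 n m k (H1 : 'M[R]_(m, n)) (H2 : 'M[R]_(k, n)) M1 M2
    (K1 : 'M[R]_(n, m)) (K2 : 'M[R]_(n, k)) P a :
    pdmx M1 -> pdmx M2 -> \rank (col_mx H1 H2) = n -> 0 < a < 1 ->
    K1 *m H1 + K2 *m H2 = 1%:M ->
    loewner_le (a^-1 *: (K1 *m M1 *m K1^T) + (1 - a)^-1 *: (K2 *m M2 *m K2^T)) P ->
  let T := invmx (fusion H1 H2 M1 M2 a) in
  loewner_le T P /\
  (P = T -> K1 = a *: (T *m H1^T *m invmx M1) /\
            K2 = (1 - a) *: (T *m H2^T *m invmx M2)).
Proof.
move=> pM1 pM2 rH a01 KH; have pF := pd_fusion pM1 pM2 rH a01.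
case/andP: a01 => a0 a1; have b0 : 0 < 1 - a by rewrite subr_gt0.
set W := _ + _ => WP T; have sT : T \is symmetricmx by case: (pd_inv pF).
have := gain_deviation H1 K1 pM1 sT (lt0r_neq0 a0).
have := gain_deviation H2 K2 pM2 sT (lt0r_neq0 b0).
rewrite /=; set L1 := a *: _; set L2 := (1 - a) *: (_ *m _ *m _).
set D1 := a^-1 *: (_ *m (K1 - _)^T); set D2 := _^-1 *: (_ *m (K2 - _)^T).
move=> dev2 dev1.
have dev : D1 + D2 = W - T.
  rewrite dev1 dev2 /W.
  have TFT : T *m (a *: info H1 M1) *m T + T *m ((1 - a) *: info H2 M2) *m T = T.
    by rewrite -mulmxDl -mulmxDr mulVmx ?mul1mx // pd_unit.
  have KT : K1 *m H1 *m T + K2 *m H2 *m T = T by rewrite -mulmxDl KH mul1mx.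
  have TK : T *m (K1 *m H1)^T + T *m (K2 *m H2)^T = T.
    rewrite -mulmxDr -[RHS]mulmx1 -(trmx1 R n) -KH.
    by rewrite [(_ + _)^T]linearD.
  rewrite addrACA [X in X + _]addrACA [X in X + _ + _]addrACA.
  by rewrite -!opprD TFT KT TK subrK.
have p1 : psdmx D1.
  by apply: psdZ; [rewrite invr_ge0 ltW|apply/psd_conj/pd_psd].
have p2 : psdmx D2.
  by apply: psdZ; [rewrite invr_ge0 ltW|apply/psd_conj/pd_psd].
have le_T : loewner_le T W by rewrite /loewner_le -dev; apply: psdD.
split; first exact: loewner_trans WP.
move=> PT; have sum0 : D1 + D2 = 0.
  by rewrite dev; apply/eqP; rewrite subr_eq0; apply/eqP/loewner_anti; rewrite // -PT.
have D1_0 : D1 = 0 := psd_add_eq0 p1 p2 sum0.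
have D2_0 : D2 = 0 by rewrite -sum0 D1_0 add0r.
split; apply/eqP; rewrite -subr_eq0; apply/eqP.
- apply: pd_conj_eq0 pM1 _; move/eqP: D1_0.
  by rewrite scaler_eq0 invr_eq0 gt_eqF //= => /eqP.
- apply: pd_conj_eq0 pM2 _; move/eqP: D2_0.
  by rewrite scaler_eq0 invr_eq0 gt_eqF //= => /eqP.
Qed.

End GaussMarkov.

(** * The Kahan-Uhlmann family *)

Section KahanUhlmann.
Context {R : realType} {n p1 p2 : nat}.
Variables (H1 : 'M[R]_(p1, n)) (H2 : 'M[R]_(p2, n)).
Hypothesis rankH : \rank (col_mx H1 H2) = n.
Implicit Types (d : fusion_input R p1 p2) (F : fusion_rule R n p1 p2) (a : R).

Let T a d : 'M[R]_n := invmx (fused_info H1 H2 a d).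

Definition admissible_at a d : Prop :=
  [/\ 0 <= a <= 1,
      loewner_lt (info1 H1 d) (info2 H2 d) -> a = 0,
      loewner_lt (info2 H2 d) (info1 H1 d) -> a = 1
    & ~ loewner_lt (info1 H1 d) (info2 H2 d) ->
      info2 H2 d <> info1 H1 d ->
      ~ loewner_lt (info2 H2 d) (info1 H1 d) ->
      fused_info H1 H2 a d \in unitmx].

Definition ku_gains a d F : Prop :=
  gain1 F d = a *: (T a d *m H1^T *m invmx (cov1 d)) /\
  gain2 F d = (1 - a) *: (T a d *m H2^T *m invmx (cov2 d)).

Lemma psd_info1 d : psdmx (info1 H1 d).
Proof. exact: psd_info (cov1_pd d). Qed.

Lemma psd_info2 d : psdmx (info2 H2 d).
Proof. exact: psd_info (cov2_pd d). Qed.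

Lemma fused0 d : fused_info H1 H2 0 d = info2 H2 d.
Proof. by rewrite /fused_info scale0r add0r subr0 scale1r. Qed.

Lemma fused1 d : fused_info H1 H2 1 d = info1 H1 d.
Proof. by rewrite /fused_info scale1r subrr scale0r addr0. Qed.

Lemma fusedB a b d : fused_info H1 H2 b d - fused_info H1 H2 a d =
  (b - a) *: (info1 H1 d - info2 H2 d).
Proof.
have fusedE c : fused_info H1 H2 c d = info2 H2 d + c *: (info1 H1 d - info2 H2 d).
  by rewrite /fused_info scalerBl scale1r scalerBr addrCA.
by rewrite !fusedE opprD addrACA subrr add0r -scalerBl.
Qed.

Lemma psd_fused a d : 0 <= a <= 1 -> psdmx (fused_info H1 H2 a d).
Proof.
case/andP=> a0 a1; apply: psdD; apply: psdZ; rewrite ?subr_ge0 //.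
  exact: psd_info1.
exact: psd_info2.
Qed.

(** A strictly dominant information matrix is positive definite; two equal ones
    coincide with their mean, which is so by observability; in the remaining
    case the matrix is semidefinite and non-singular. *)
Lemma admissible_pd a d : admissible_at a d -> pdmx (fused_info H1 H2 a d).
Proof.
case=> a01 lt12 lt21 other.
have [l12|n12] := pselect (loewner_lt (info1 H1 d) (info2 H2 d)).
  by rewrite (lt12 l12) fused0; apply: loewner_lt_pd l12; apply: psd_info1.
have [l21|n21] := pselect (loewner_lt (info2 H2 d) (info1 H1 d)).
  by rewrite (lt21 l21) fused1; apply: loewner_lt_pd l21; apply: psd_info2.
have [e12|ne12] := eqVneq (info2 H2 d) (info1 H1 d).
  have <- : fused_info H1 H2 (1 / 2) d = fused_info H1 H2 a d.
    by apply/eqP; rewrite -subr_eq0 fusedB e12 subrr scaler0.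
  by apply: pd_fusion (cov1_pd d) (cov2_pd d) rankH _; lra.
by apply: psd_unit_pd; [exact: psd_fused|apply: other => //; apply/eqP].
Qed.

(** Evaluated at the gains, the form of [Pjoint] is taken at the convex
    combination of [col_mx z1 0] and [col_mx 0 z2] with weights [a] and
    [1 - a].  By convexity it is at most the combination of the values of [P1]
    at [z1] and of [P2] at [z2]; replacing these matrices by their bounds gives
    exactly the form of the inverse fused information. *)
Lemma ku_conservative alpha :
  admissible_weight H1 H2 alpha ->
  conservative_rule H1 H2 (ku_rule H1 H2 alpha).
Proof.
move=> adm; have pF d := admissible_pd (adm d); split=> [d|d|].
- exact/pd_inv/pF.
- rewrite /= -!scalemxAl -!mulmxA.
  rewrite [X in X + _]scalemxAr [X in _ + X]scalemxAr -mulmxDr !mulmxA.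
  exact/mulVmx/pd_unit/pF.
move=> d P1 B P2 Pj K pPj le1 le2.
rewrite {}/K {}/Pj in pPj *.
have [/andP[a0 a1] _ _ _] := adm d; rewrite /=.
have pFd := pF d; set a := alpha d in a0 a1 pFd *.
set S := invmx _.
have sS : S \is symmetricmx by case: (pd_inv pFd).
have [[sM1 _] [sM2 _]] := (cov1_pd d, cov2_pd d).
have sP1 : P1 \is symmetricmx.
  by rewrite -(subKr (cov1 d) P1); apply: symB => //; case: le1.
have sP2 : P2 \is symmetricmx.
  by rewrite -(subKr (cov2 d) P2); apply: symB => //; case: le2.
split.
  by apply: symB => //; apply: sym_conj; case: pPj.
move=> w; rewrite -/(bform _ w w) formBm form_joint //.
pose z1 := invmx (cov1 d) *m (H1 *m (S *m w)).
pose z2 := invmx (cov2 d) *m (H2 *m (S *m w)).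
have tr_gain m c (H : 'M[R]_(m, n)) M : M \is symmetricmx ->
    (c *: (S *m H^T *m invmx M))^T *m w = c *: (invmx M *m (H *m (S *m w))).
  move=> /symmxP sM.
  by rewrite linearZ /= !trmx_mul trmxK trmx_inv sM (symmxP _ sS) -scalemxAl !mulmxA.
rewrite !tr_gain // -/z1 -/z2 !formZl !formZr.
have -> : bform S w w = a * bform (cov1 d) z1 z1 + (1 - a) * bform (cov2 d) z2 z2.
  rewrite /z1 /z2 !form_invK; [|exact: cov2_pd|exact: cov1_pd].
  rewrite -(form_invK w pFd) {1}/fused_info formDm !formZm.
  by rewrite !form_info.
have := psd_ge0 z1 le1; have := psd_ge0 z2 le2; rewrite !formBm => i2 i1.
(* Convexity along a segment is nonnegativity at the difference of its ends. *)
have := psd_ge0 (col_mx z1 (- z2)) (pd_psd pPj).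
rewrite form_block -(scaleN1r z2) !formZr !formZl => i3.
have j1 : 0 <= a * (bform (cov1 d) z1 z1 - bform P1 z1 z1) by apply: mulr_ge0.
have j2 : 0 <= (1 - a) * (bform (cov2 d) z2 z2 - bform P2 z2 z2).
  by apply: mulr_ge0 => //; rewrite subr_ge0.
have b0 : 0 <= 1 - a by rewrite subr_ge0.
have j3 := mulr_ge0 (mulr_ge0 a0 b0) i3.
lra.
Qed.

(** A vanishing gain makes the bound on the other sensor exact, and puts the
    weight at an endpoint; otherwise the weight comes from
    [conservative_inflation]. *)
Lemma dominating_weight F d : conservative_rule H1 H2 F ->
  exists a, [/\ 0 <= a <= 1, pdmx (fused_info H1 H2 a d),
    loewner_le (T a d) (bound F d) & bound F d = T a d -> ku_gains a d F].
Proof.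
case=> /(_ d) pP /(_ d) KH /(_ d) cons.
have [pM1 pM2] := (cov1_pd d, cov2_pd d).
have [[[sM1 _] [sM2 _]] [sP _]] := (pM1, pM2, pP).
have le_refl m (A : 'M[R]_m) : loewner_le A A.
  rewrite /loewner_le subrr; split; first by apply/symmxP; rewrite trmx0.
  by move=> v; rewrite mulmx0 mul0mx mxE.
have [B0 pB0 B00] : exists2 B, pdmx (block_mx (cov1 d) B B^T (cov2 d))
    & forall x, bform B x 0 = 0 * bform (cov1 d) x 0.
  by apply: cross_covariance; rewrite ?lexx ?ltr01 ?form0r.
have le0 := cons _ _ _ pB0 (le_refl _ _) (le_refl _ _).
have [K2z|K2nz] := eqVneq (gain2 F d) 0.
  have {}KH : gain1 F d *m H1 = 1%:M by rewrite -KH K2z mul0mx addr0.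
  have [|pI leT eqT] := gauss_markov1 pM1 KH (P := bound F d).
    split; first by apply: symB => //; apply: sym_conj.
    move=> v; have := psd_ge0 v le0; rewrite -/(bform _ v v) !formBm form_joint //.
    by rewrite form_conj K2z trmx0 mul0mx B00 !form0r mul0r mulr0 !addr0.
  exists 1; rewrite /ku_gains /T fused1 ler01 lexx; split=> // PT.
  by rewrite scale1r subrr scale0r; split=> //; apply: eqT.
have [K1z|K1nz] := eqVneq (gain1 F d) 0.
  have {}KH : gain2 F d *m H2 = 1%:M by rewrite -KH K1z mul0mx add0r.
  have [|pI leT eqT] := gauss_markov1 pM2 KH (P := bound F d).
    split; first by apply: symB => //; apply: sym_conj.
    move=> v; have := psd_ge0 v le0; rewrite -/(bform _ v v) !formBm form_joint //.
    by rewrite form_conj K1z trmx0 mul0mx !form0l mulr0 !add0r.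
  exists 0; rewrite /ku_gains /T fused0 ler01 lexx; split=> // PT.
  by rewrite scale0r subr0 scale1r; split=> //; apply: eqT.
have [|a a01 leP] := conservative_inflation pM1 pM2 sP K1nz K2nz.
  by move=> B pB; apply: cons.
have [leT eqT] := gauss_markov2 pM1 pM2 rankH a01 KH leP.
exists a; split=> //; last exact: pd_fusion.
by case/andP: a01 => a0 a1; rewrite !ltW.
Qed.

(** If one information matrix strictly dominates, giving it full weight
    maximises the fused information and thus minimises the bound.  Should the
    bounds at both weights coincide, so do the weights, because the fused
    information is affine and nonconstant in the weight. *)
Lemma admissible_dominating_weight F d : (0 < n)%N ->
    conservative_rule H1 H2 F ->
  exists a, [/\ admissible_at a d, loewner_le (T a d) (bound F d)
    & bound F d = T a d -> ku_gains a d F].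
Proof.
move=> n_gt0 consF; have [a [a01 pFa leT eqT]] := dominating_weight d consF.
have improve b : 0 <= b <= 1 -> pdmx (fused_info H1 H2 b d) ->
    info1 H1 d != info2 H2 d ->
    loewner_le (fused_info H1 H2 a d) (fused_info H1 H2 b d) ->
    loewner_le (T b d) (bound F d) /\ (bound F d = T b d -> ku_gains b d F).
  move=> b01 pFb ne leab; have leTba := loewner_inv pFa pFb leab.
  split; first exact: loewner_trans leT.
  move=> PTb; have Tab : T a d = T b d.
    by apply: loewner_anti => //; rewrite -PTb.
  have /eqP : fused_info H1 H2 b d = fused_info H1 H2 a d.
    by rewrite -[LHS]invmxK -[RHS]invmxK -/(T b d) -Tab.
  rewrite -subr_eq0 fusedB scaler_eq0 !subr_eq0 (negPf ne) orbF => /eqP ->.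
  by apply: eqT; rewrite Tab.
have lt_neq (A B : 'M[R]_n) : loewner_lt A B -> A != B.
  case=> _ ltAB; apply/eqP => AB.
  have /ltAB : delta_mx (Ordinal n_gt0) 0 != 0 :> 'cV[R]_n.
    apply/eqP => /matrixP/(_ (Ordinal n_gt0) 0)/eqP.
    by rewrite !mxE !eqxx oner_eq0.
  by rewrite AB subrr mulmx0 mul0mx mxE ltxx.
have lt_asym (A B : 'M[R]_n) : loewner_lt A B -> loewner_lt B A -> False.
  move=> AB BA; have /eqP := lt_neq _ _ AB; apply.
  exact: loewner_anti (pd_psd AB) (pd_psd BA).
have [a0 a1] := andP a01.
have [l12|n12] := pselect (loewner_lt (info1 H1 d) (info2 H2 d)).
  have [] := improve 0.
  - by rewrite lexx ler01.
  - by rewrite fused0; apply: loewner_lt_pd l12; apply: psd_info1.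
  - exact: lt_neq.
  - rewrite /loewner_le fusedB sub0r scaleNr -scalerN opprB.
    exact/psdZ/pd_psd.
  move=> leT0 eqT0; exists 0; split=> //; split=> //.
  - by rewrite lexx ler01.
  - by move/(lt_asym _ _ l12).
have [l21|n21] := pselect (loewner_lt (info2 H2 d) (info1 H1 d)).
  have [] := improve 1.
  - by rewrite lexx ler01.
  - by rewrite fused1; apply: loewner_lt_pd l21; apply: psd_info2.
  - by rewrite eq_sym lt_neq.
  - by rewrite /loewner_le fusedB; apply/psdZ/pd_psd; rewrite ?subr_ge0.
  move=> leT1 eqT1; exists 1; split=> //; split=> //.
  by rewrite lexx ler01.
by exists a; split=> //; split=> // *; apply: pd_unit.
Qed.

End KahanUhlmann.

(** * Optimal rules belong to the family *)

Theorem theorem21 (R : realType) (n p1 p2 : nat)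
    (n_gt0 : (0 < n)%N) (p1_gt0 : (0 < p1)%N) (p2_gt0 : (0 < p2)%N)
    (le_p1n : (p1 <= n)%N) (le_p2n : (p2 <= n)%N)
    (H1 : 'M[R]_(p1, n)) (H2 : 'M[R]_(p2, n))
    (A1 : full_rank_observations H1 H2)
    (J : 'M[R]_n -> R) (J_isotone : strictly_isotone J)
    (F : fusion_rule R n p1 p2)
    (F_optimal : J_optimal_over J (conservative_rule H1 H2) F) :
  kahan_uhlmann H1 H2 F /\ J_optimal_over J (kahan_uhlmann H1 H2) F.
Proof.
case: A1 => _ _ rankH; case: F_optimal => consF optF.
have [alpha alphaP] := choice (fun d => admissible_dominating_weight rankH d n_gt0 consF).
have adm : admissible_weight H1 H2 alpha by move=> d; case: (alphaP d).
have boundF d : bound F d = bound (ku_rule H1 H2 alpha) d.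
  have [_ leF _] := alphaP d; have consK := ku_conservative rankH adm.
  have sym G : conservative_rule H1 H2 G -> bound G d \is symmetricmx.
    by case=> /(_ d) [].
  have [_ strict] := J_isotone _ _ (sym _ consK) (sym _ consF).
  apply: contrapT => /nesym /(strict leF).
  by rewrite ltNge optF.
have kuF : kahan_uhlmann H1 H2 F.
  by exists alpha => //; split=> // d; have [_ _ /(_ (boundF d)) []] := alphaP d.
split=> //; split=> // G [beta admb [_ _ boundG]] d.
by rewrite boundG; apply: optF; apply: ku_conservative.
Qed.
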